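(* Let $\mathscr{B}\subset\mathbb{N}$ and let $\eta$ be the characteristic function of the corresponding $\mathscr{B}$-free set. Then exactly one of the following holds: - $(X_\eta,S)$ is proximal, and then for infinitely many $k\ge1$ the block of the form $10\ldots01$ (with $k$ zeros between the $1$'s) is of positive Mirsky measure $\nu_\eta$; - $(X_\eta,S)$ is not proximal, and then $\eta$ contains a two-sided infinite arithmetic progression (i.e. $\{n\in\mathbb{Z}:\eta(n)=1\}\supset a+L\mathbb{Z}$ for some $a\in\mathbb{Z}$, $L\ge1$).
   Context: For $\mathscr{B}\subset\mathbb{N}=\{1,2,\ldots\}$ put $\mathcal{M}_{\mathscr{B}}=\bigcup_{b\in\mathscr{B}}b\mathbb{Z}$ and $\mathcal{F}_{\mathscr{B}}=\mathbb{Z}\setminus\mathcal{M}_{\mathscr{B}}$ (the $\mathscr{B}$-free set). Let $\eta=\mathbf{1}_{\mathcal{F}_{\mathscr{B}}}\in\{0,1\}^{\mathbb{Z}}$, let $S$ be the left shift on $\{0,1\}^{\mathbb{Z}}$, and let $X_\eta$ be the closure of the orbit $\{S^n\eta:n\in\mathbb{Z}\}$. The Mirsky measure $\nu_\eta$ is the $S$-invariant Borel probability measure on $\{0,1\}^{\mathbb{Z}}$ such that $\frac1{N_k}\sum_{n\le N_k}\delta_{S^n\eta}\to\nu_\eta$ weakly for every increasing sequence $(N_k)$ with $\frac1{N_k}|\mathcal{M}_{\mathscr{B}}\cap[1,N_k]|\to\underline{d}(\mathcal{M}_{\mathscr{B}})$, where $\underline{d}$ denotes lower asymptotic density (it is known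 to exist). The measure of a block $w_0\ldots w_m$ is the $\nu_\eta$-measure of the cylinder $\{x:x_i=w_i,\ 0\le i\le m\}$. A topological dynamical system $(X,T)$ (homeomorphism of a compact metric space with metric $d$) is proximal if $\liminf_{n\to\infty}d(T^nx,T^ny)=0$ for all $x,y\in X$.
   Formalization: It is assumed in addition that 𝓑 is nonempty and that the lower asymptotic density of M_𝓑 is less than 1; for 𝓑 empty, 𝓑={1} or any 𝓑 with lower density 1, no block 10…01 with k≥1 zeros has positive measure and neither alternative holds. *)

(* Defs.v *)
From HB Require Import structures.
From mathcomp Require Import all_boot all_order all_algebra.
From mathcomp Require Import all_classical all_reals all_analysis.

Set Implicit Arguments.
Unset Strict Implicit.
Unset Printing Implicit Defensive.

Import Order.TTheory GRing.Theory Num.Theory.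
Import numFieldNormedType.Exports.

Local Open Scope classical_set_scope.
Local Open Scope ring_scope.

Definition exactly_one (P Q : Prop) : Prop := (P \/ Q) /\ ~ (P /\ Q).

(* [d] is a metric on the subset [X] of [T] inducing the subspace topology of
   [X]; the values of [d] outside [X] are irrelevant. *)
Definition metric_on (R : realType) (T : topologicalType) (X : set T)
    (d : T -> T -> R) : Prop :=
  [/\ forall x y, X x -> X y -> 0 <= d x y,
      forall x y, X x -> X y -> (d x y = 0 <-> x = y),
      forall x y, X x -> X y -> d x y = d y x,
      forall x y z, X x -> X y -> X z -> d x z <= d x y + d y z
    & forall x (A : set T), X x ->
        within X (nbhs x) A <->
        exists2 e : R, 0 < e & forall y, X y -> d x y < e -> A y].

Definition proximal (R : realType) (T : Type) (X : set T) (d : T -> T -> R)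
    (f : T -> T) : Prop :=
  forall x y, X x -> X y ->
    limn_einf (fun n => (d (iter n f x) (iter n f y))%:E) = 0%E.

Notation borel T := (g_sigma_algebraType (@open T)).

Definition weak_cvg (R : realType) (T : ptopologicalType)
    (mu : nat -> {measure set (borel T) -> \bar R})
    (nu : {measure set (borel T) -> \bar R}) : Prop :=
  forall f : T -> R, continuous f -> bounded_fun f ->
    (\int[mu k]_x (f x)%:E)%E @[k --> \oo] --> (\int[nu]_x (f x)%:E)%E.

(* 1/N * (sum of the Dirac masses at f^n x, 1 <= n <= N) *)
Definition empirical_measure (R : realType) (T : ptopologicalType)
    (f : T -> T) (x : T) (N : nat) : {measure set (borel T) -> \bar R} :=
  mscale (N%:R^-1)%:nng
    (msum (fun i => dirac (iter i.+1 f x : borel T)) N).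

Definition full_shift : Type := {ptws int -> bool}.

HB.instance Definition _ := Pointed.on full_shift.
HB.instance Definition _ := Nbhs.on full_shift.
HB.instance Definition _ := Topological.on full_shift.

Definition shiftz (n : int) (x : full_shift) : full_shift :=
  fun i => x (i + n).

Definition left_shift : full_shift -> full_shift := shiftz 1.

Lemma iter_left_shift (n : nat) (x : full_shift) : iter n left_shift x = shiftz n%:Z x.
Proof.
elim: n => [|n IHn]; first by apply/funext => i; rewrite /shiftz addr0.
by rewrite iterS IHn; apply/funext => i; rewrite /left_shift /shiftz -addrA -intS.
Qed.

Definition orbit_closure (x : full_shift) : set full_shift :=
  closure (range (fun n : int => shiftz n x)).

(* [x_i = w_i] for [0 <= i < size w] *)
Definition cylinder (w : seq bool) : set full_shift :=
  [set x | forall i, (i < size w)%N -> x i%:Z = nth false w i].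

(* the block 10...01 with [k] zeros *)
Definition block (k : nat) : seq bool := true :: rcons (nseq k false) true.

(* The set B of positive integers is encoded as a [set nat] not containing 0;
   this last condition is a hypothesis wherever it matters. *)
Definition multiples (B : set nat) : set int :=
  \bigcup_(b in B) range (fun m : int => b%:Z * m).

Definition free_set (B : set nat) : set int := ~` multiples B.

Definition eta (B : set nat) : full_shift := fun n => n \in free_set B.

(* |A /\ [1, N]| / N *)
Definition freq (R : realType) (A : set int) (N : nat) : R :=
  (\sum_(1 <= n < N.+1) (n%:Z \in A))%N%:R / N%:R.

Definition lower_density (R : realType) (A : set int) : \bar R :=
  limn_einf (fun N => (freq R A N)%:E).

Definition is_mirsky (R : realType) (B : set nat)
    (nu : probability (borel full_shift) R) : Prop :=
  (forall A : set (borel full_shift), measurable A -> nu (left_shift @^-1` A) = nu A) /\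
  forall N : nat -> nat, {homo N : i j / (i < j)%N} ->
    (freq R (multiples B) (N k))%:E @[k --> \oo] -->
      lower_density R (multiples B) ->
    weak_cvg (fun k => empirical_measure R left_shift (eta B) (N k)) nu.

(* Main.v *)
Require Import Defs.
From mathcomp Require Import all_boot all_order all_algebra.
From mathcomp Require Import all_classical all_reals all_analysis.
From mathcomp Require Import zify ring lra.

Set Implicit Arguments.
Unset Strict Implicit.
Unset Printing Implicit Defensive.

Import Order.TTheory GRing.Theory Num.Theory.
Import numFieldNormedType.Exports.

Local Open Scope classical_set_scope.
Local Open Scope ring_scope.

(** Everything turns on whether every L >= 1 is coprime to some element of B.

    If some L is not, then 1 + LZ is B-free, because every divisor of 1 + L m is
    coprime to L.  A B-free progression excludes proximality: applied to eta and
    its shift, proximality yields, by compactness, a fixed point of the shift in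
    X_eta.  The constant 0 is not in X_eta because the ones of eta on the
    progression have bounded gaps, and the constant 1 is not in X_eta because eta
    vanishes on bZ for any b in B.

    If every L is coprime to some b, the Chinese remainder theorem produces, for
    each r, a single period L such that any r prescribed translates of some
    progression n0 + LZ consist of zeros of eta ([zeros_along_progression]).  The
    point is that L does not depend on the r translations.  Hence (X_eta, S) is
    proximal: x and y in X_eta agree with two shifts of eta on windows long
    compared with L, and one residue class n0 makes both vanish on long windows
    around a common time ([common_zero_window]), so both orbits approach the
    point 0 of X_eta simultaneously ([coprime_rich_proximal]).

    The same runs of zeros give the blocks ([coprime_rich_blocks]).  Along a
    sequence that realizes the lower density, the empirical measures show that
    nu {x_0 = 1} = 1 - (lower density) > 0, and that nu-almost every x has a run
    of K + 1 zeros starting in [0, L).  By Poincare recurrence almost every x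
    with x_0 = 1 has a further 1 beyond that run, and the two ones nearest to the
    run enclose a block 10...01 with more than K zeros ([block_between]).  Hence
    the shifted cylinders of these blocks cover {x_0 = 1} up to a null set, and
    one of them has positive measure.  As K is arbitrary, infinitely many lengths
    occur. *)

(** * Zeros of eta along arithmetic progressions *)

(** For 1 not in B this says that B has an infinite pairwise coprime subset: the
    elements can be chosen one after the other, each coprime to the product of
    its predecessors.  For 1 in B it holds trivially. *)
Definition coprime_rich (B : set nat) : Prop :=
  forall L, (0 < L)%N -> exists2 b, B b & coprime b L.

Lemma etaE (B : set nat) (n : int) : eta B n = (n \notin multiples B).
Proof. by rewrite /eta /free_set in_setC. Qed.

Lemma etaP (B : set nat) (n : int) :
  eta B n = false <-> exists2 b, B b & (b%:Z %| n)%Z.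
Proof.
rewrite etaE; split=> [/negbFE/set_mem[b Bb [m _ <-]]|[b Bb /dvdzP[m ->]]].
  by exists b => //; exact: dvdz_mulr.
by apply/negbF/mem_set; exists b => //; exists m => //; rewrite mulrC.
Qed.

Lemma not_coprime_rich_progression (B : set nat) : ~ coprime_rich B ->
  exists a L : int, 1 <= L /\
    range (fun m : int => a + L * m) `<=` [set n | eta B n = true].
Proof.
move=> /existsNP[L /not_implyP[L0 nB]].
exists 1, L%:Z; split; first by rewrite lez_nat.
move=> _ [m _ <-] /=; apply/negPn/negP => /negbTE/etaP[b Bb bd].
apply: nB; exists b => //.
have : (gcdz b%:Z L%:Z %| 1)%Z.
  have -> : 1%Z = 1 + L%:Z * m - L%:Z * m by ring.
  apply: rpredB; first exact: dvdz_trans (dvdz_gcdl _ _) bd.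
  by apply: dvdz_mulr; exact: dvdz_gcdr.
by rewrite /coprime dvdzE /= dvdn1.
Qed.

(** The modulus L is a product of r pairwise coprime elements of B, one for each
    shift.  It is chosen before the shifts [cs]: the shifts used for proximality
    depend on how closely points of X_eta are approximated, and this in turn
    depends on L. *)
Lemma zeros_along_progression (B : set nat) : (forall b, B b -> (0 < b)%N) ->
  coprime_rich B -> forall r : nat, exists2 L : nat, (0 < L)%N &
  forall cs : seq int, size cs = r -> exists n0 : int,
    forall m c, c \in cs -> eta B (n0 + L%:Z * m + c) = false.
Proof.
move=> hB rich; elim=> [|r [L L0 IH]].
  by exists 1%N => // -[] // _; exists 0.
have [b Bb bL] := rich L L0.
have [u [v uv]] : exists u v : int, u * L%:Z + v * b%:Z = 1.
  have [u [v uv]] := Bezoutz L%:Z b%:Z; exists u, v.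
  by rewrite uv /gcdz /= gcdnC (eqP bL).
exists (L * b)%N; first by rewrite muln_gt0 L0 hB.
move=> [//|c cs] [/IH[n0 n0P]].
(* Bezout: this start is n0 modulo L and - c modulo b. *)
exists (n0 - L%:Z * (u * (n0 + c))) => m c'; rewrite inE PoszM.
move=> /predU1P[->|cs'].
  apply/etaP; exists b => //; apply/dvdzP; exists (v * (n0 + c) + L%:Z * m).
  rewrite [LHS](_ : _ =
    (n0 + c) * 1 + (L%:Z * b%:Z * m - L%:Z * (u * (n0 + c)))); last by ring.
  by rewrite -uv; ring.
rewrite -(n0P (b%:Z * m - u * (n0 + c)) c' cs'); congr (eta B _); ring.
Qed.

Lemma progression_meets_interval (L : nat) (n0 M : int) : (0 < L)%N ->
  exists m, M <= n0 + L%:Z * m < M + L%:Z.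
Proof.
move=> L0; exists (- ((n0 - M) %/ L%:Z)%Z).
have -> : n0 + L%:Z * - ((n0 - M) %/ L%:Z)%Z = M + ((n0 - M) %% L%:Z)%Z.
  move: (divz_eq (n0 - M) L%:Z).
  move: (_ %/ _)%Z (_ %% _)%Z => q t /eqP; rewrite subr_eq => /eqP->; ring.
rewrite lerDl modz_ge0 ?ltrD2l ?ltz_pmod //; lia.
Qed.

(** * Topology of the full shift *)

Definition window (k : nat) (x : full_shift) : set full_shift :=
  [set y | forall i : int, (`|i| <= k)%N -> y i = x i].

Lemma nbhs_windowP (x : full_shift) (A : set full_shift) :
  nbhs x A <-> exists k, window k x `<=` A.
Proof.
split; last first.
  move=> [k kA]; apply: filterS kA _.
  have evx (i : int) : \forall y \near x, y i = x i.
    have : {for x, continuous (fun y : {ptws int -> bool} => y i)}.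
      exact: (@proj_continuous int (fun=> bool) i).
    move=> /(_ [set x i]); apply; exact: discrete_set1.
  elim: k => [|k IH].
    by near=> y; move=> i; rewrite leqn0 absz_eq0 => /eqP->; near: y; exact: evx.
  near=> y; move=> i; rewrite leq_eqVlt => /predU1P[ik|]; last first.
    by rewrite ltnS; move: i; near: y; exact: IH.
  have [->|->] : i = k.+1 \/ i = - k.+1%:Z by lia.
    by near: y; exact: evx.
  by near: y; exact: evx.
(* The filter generated by the windows converges to x coordinatewise, hence in
   the product topology, so it contains every neighbourhood of x. *)
pose F : set_system full_shift := filter_from setT (fun k => window k x).
have FF : Filter F.
  apply: filter_from_filter; first by exists 0%N.
  move=> i j _ _; exists (maxn i j) => // y yx.
  by split=> k ki; apply: yx; rewrite leq_max ki ?orbT.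
have : F --> (x : {ptws int -> bool}).
  apply/cvg_sup => i V [_ [[C _ <-] Cx] CV].
  exists `|i|%N => // y yx; apply: CV.
  by rewrite /= /proj (yx i (leqnn _)).
by move=> /[apply] -[k _ ?]; exists k.
Unshelve. all: by end_near.
Qed.

Lemma window_open (k : nat) (A : set full_shift) :
  (forall x, A x -> window k x `<=` A) -> open A.
Proof.
by move=> lA; rewrite openE => x /lA ?; apply/nbhs_windowP; exists k.
Qed.

Lemma window_clopen (k : nat) (A : set full_shift) :
  (forall x, A x -> window k x `<=` A) -> open A /\ open (~` A).
Proof.
move=> lA; split; first exact: window_open lA.
apply: (@window_open k) => x nAx y xy Ay; apply: nAx.
by apply: (lA y Ay) => i ik; rewrite xy.
Qed.

Lemma cylinder_clopen w : open (cylinder w) /\ open (~` cylinder w).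
Proof.
apply: (@window_clopen (size w)) => x xw y yx i iw.
by rewrite yx ?xw //; exact: ltnW.
Qed.

Lemma orbit_closureP (x y : full_shift) :
  orbit_closure x y <-> forall k, exists n, window k y (shiftz n x).
Proof.
split=> [xy k|H A /nbhs_windowP[k kA]].
  have /xy[_ [[n _ <-] ?]] : nbhs y (window k y) by apply/nbhs_windowP; exists k.
  by exists n.
by have [n ?] := H k; exists (shiftz n x); split; [exists n|exact: kA].
Qed.

Lemma orbit_closure_refl (x : full_shift) : orbit_closure x x.
Proof.
by apply/orbit_closureP => k; exists 0 => i _; rewrite /shiftz addr0.
Qed.

Lemma orbit_closure_shift (x y : full_shift) (n : int) :
  orbit_closure x y -> orbit_closure x (shiftz n y).
Proof.
move=> /orbit_closureP xy; apply/orbit_closureP => k.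
have [m xm] := xy (k + `|n|)%N; exists (m + n) => i ik.
rewrite -[LHS]/(x (i + (m + n))) -[RHS]/(y (i + n)) -(xm (i + n)); last by lia.
by rewrite /shiftz; congr (x _); ring.
Qed.

Lemma orbit_closure_compact (x : full_shift) : compact (orbit_closure x).
Proof.
apply: (@subclosed_compact _ _ [set: full_shift]) => //.
  exact: closed_closure.
have -> : [set: full_shift] =
    [set f : {ptws int -> bool} | forall i, [set: bool] (f i)].
  by apply/seteqP; split.
exact: (@tychonoff int (fun=> bool) (fun=> setT) (fun=> bool_compact)).
Qed.

(** * Lower limits of real sequences *)

Lemma limn_einf_approx (R : realType) (u : nat -> R) (l : R) :
  limn_einf (fun n => (u n)%:E) = l%:E ->
  forall e, 0 < e -> forall M, exists2 n, (M <= n)%N & `|u n - l| < e.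
Proof.
rewrite limn_einf_lim (cvg_lim _ (@cvg_einfs_sup _ _)) // => supl e e0 M.
have : ((l - e)%:E < ereal_sup (range (einfs (fun n => (u n)%:E))))%E.
  by rewrite supl lte_fin ltrBlDr ltrDl.
move=> /ereal_sup_gt[_ [n _ <-] ln].
have lN : ((l - e)%:E < einfs (fun n => (u n)%:E) (maxn M n))%E.
  by apply: lt_le_trans ln _; apply: nondecreasing_einfs; exact: leq_maxr.
have : (einfs (fun n => (u n)%:E) (maxn M n) < (l + e)%:E)%E.
  apply: (@le_lt_trans _ _ l%:E); last by rewrite lte_fin ltrDl.
  by rewrite -supl; apply: ereal_sup_ubound; exists (maxn M n).
move=> /ereal_inf_lt[_ [N /= MN <-]]; rewrite lte_fin => uN.
exists N; first by apply: leq_trans MN; exact: leq_maxl.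
have : ((l - e)%:E < (u N)%:E)%E.
  by apply: lt_le_trans lN _; apply: ereal_inf_lbound; exists N.
by rewrite lte_fin ltr_norml => ?; apply/andP; split; lra.
Qed.

Lemma limn_einf_eq0 (R : realType) (u : nat -> R) : (forall n, 0 <= u n) ->
  (forall e, 0 < e -> forall M, exists2 n, (M <= n)%N & u n < e) ->
  limn_einf (fun n => (u n)%:E) = 0%E.
Proof.
move=> u0 small; rewrite limn_einf_lim.
suff -> : einfs (fun n => (u n)%:E) = cst 0%E by exact: lim_cst.
apply/funext => M; apply/eqP; rewrite eq_le; apply/andP; split.
  apply/lee_addgt0Pr => e e0; rewrite add0e.
  have [n Mn /ltW un] := small e e0 M.
  by apply: ereal_inf_le; exists (u n)%:E; [exists n|rewrite lee_fin].
by apply: le_ereal_inf_tmp => _ [n _ <-]; rewrite lee_fin.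
Qed.

(** * Proximality *)

(** This and the next lemma replace the metric by the combinatorial windows at a
    fixed centre. *)
Lemma metric_window (R : realType) (X : set full_shift) d (x : full_shift) e :
  metric_on (R := R) X d -> X x -> 0 < e ->
  exists k, forall y, X y -> window k x y -> d x y < e.
Proof.
move=> [_ _ _ _ top] Xx e0.
have : within X (nbhs x) [set y | d x y < e] by apply/top => //; exists e.
by move=> /nbhs_windowP[k kX]; exists k => y Xy /kX; exact.
Qed.

Lemma window_metric (R : realType) (X : set full_shift) d (x : full_shift) k :
  metric_on (R := R) X d -> X x ->
  exists2 e, 0 < e & forall y, X y -> d x y < e -> window k x y.
Proof.
move=> [_ _ _ _ top] Xx; apply/(top _ (window k x) Xx)/nbhs_windowP.
by exists k => y.
Qed.

Definition zero_shift : full_shift := fun=> false.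

(** Shifts s and t of eta approximate x and y on [-(M + L + k), M + L + k].  The
    required zeros are those of eta on n + s + j and n + t + j for |j| <= k, a
    number of conditions that depends on k only, and a solution n modulo L is
    available in [M, M + L), inside the range of the approximation. *)
Lemma common_zero_window (B : set nat) (x y : full_shift) (k M : nat) :
  (forall b, B b -> (0 < b)%N) -> coprime_rich B ->
  orbit_closure (eta B) x -> orbit_closure (eta B) y ->
  exists2 n, (M <= n)%N &
    window k zero_shift (shiftz n%:Z x) /\ window k zero_shift (shiftz n%:Z y).
Proof.
move=> hB rich /orbit_closureP Xx /orbit_closureP Xy.
pose js : seq int := [seq i%:Z - k%:Z | i <- iota 0 (k + k).+1].
have jsP j : (`|j| <= k)%N -> j \in js.
  move=> jk; apply/mapP; exists (absz (j + k%:Z)); last by lia.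
  by rewrite mem_iota; lia.
have [L L0 prog] := zeros_along_progression hB rich (size js + size js).
have [s xs] := Xx (M + L + k)%N; have [t yt] := Xy (M + L + k)%N.
have [|n0 n0P] := prog ([seq j + s | j <- js] ++ [seq j + t | j <- js]).
  by rewrite size_cat !size_map.
have [m /andP[Mm mL]] := progression_meets_interval n0 M%:Z L0.
exists (absz (n0 + L%:Z * m)); first by lia.
rewrite gez0_abs; last by lia.
split=> j jk.
  rewrite -[LHS]/(x (j + _)) -xs; last by lia.
  rewrite -[RHS](n0P m (j + s)).
    by rewrite /shiftz; congr (eta B _); ring.
  by rewrite mem_cat (map_f (+%R^~ s) (jsP j jk)).
rewrite -[LHS]/(y (j + _)) -yt; last by lia.
rewrite -[RHS](n0P m (j + t)); first by rewrite /shiftz; congr (eta B _); ring.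
by rewrite mem_cat (map_f (+%R^~ t) (jsP j jk)) orbT.
Qed.

Lemma coprime_rich_proximal (R : realType) (B : set nat) d :
  (forall b, B b -> (0 < b)%N) ->
  metric_on (R := R) (orbit_closure (eta B)) d ->
  coprime_rich B -> proximal (orbit_closure (eta B)) d left_shift.
Proof.
move=> hB hd rich x y Xx Xy; under eq_fun do rewrite !iter_left_shift.
have [d0 _ dC dD _] := hd.
have X0 : orbit_closure (eta B) zero_shift.
  apply/orbit_closureP => k; have Xe := @orbit_closure_refl (eta B).
  by have [n _ [? _]] := common_zero_window k 0 hB rich Xe Xe; exists n%:Z.
apply: limn_einf_eq0 => [n|e e0 M].
  by apply: d0; exact: orbit_closure_shift.
have e2 : 0 < e / 2 by lra.
have [k kP] := metric_window hd X0 e2.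
have [n Mn [nx ny]] := common_zero_window k M hB rich Xx Xy.
exists n => //.
have Xnx := @orbit_closure_shift _ _ n%:Z Xx.
have Xny := @orbit_closure_shift _ _ n%:Z Xy.
apply: le_lt_trans (dD _ _ _ Xnx X0 Xny) _; rewrite dC //.
by have := kP _ Xnx nx; have := kP _ Xny ny; lra.
Qed.

(** Proximality of x and S x along times g j gives d (u j) (S (u j)) -> 0 for
    u j = S^(g j) x; a cluster point z of u in the compact orbit closure then
    satisfies S z = z. *)
Lemma proximal_fixed_point (R : realType) (x : full_shift) d :
  metric_on (R := R) (orbit_closure x) d ->
  proximal (orbit_closure x) d left_shift ->
  exists2 z, orbit_closure x z & left_shift z = z.
Proof.
move=> hd prox; have [d0 _ dC dD _] := hd.
have Xx := @orbit_closure_refl x.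
have XS y : orbit_closure x y -> orbit_closure x (left_shift y).
  exact: orbit_closure_shift.
have /choice[g gP] (j : nat) : exists n : nat,
    d (shiftz n%:Z x) (left_shift (shiftz n%:Z x)) < j.+1%:R^-1.
  have r0 : 0 < j.+1%:R^-1 :> R by rewrite invr_gt0 ltr0n.
  have [n _] := limn_einf_approx (prox _ _ Xx (XS _ Xx)) r0 0.
  rewrite subr0 -iterSr iterS iter_left_shift => /(le_lt_trans (ler_norm _)).
  by exists n.
pose u j : full_shift := shiftz (g j)%:Z x.
have Xu j : orbit_closure x (u j) by exact: orbit_closure_shift.
have [z [Xz zu]] : orbit_closure x `&` cluster (u @ \oo) !=set0.
  by apply: orbit_closure_compact; exists 0%N => // j _; exact: Xu.
exists z => //; apply/funext => i.
have [e e0 eP] := window_metric `|i|%N hd (XS _ Xz).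
have e2 : 0 < e / 2 by lra.
have [k kP] := metric_window hd (XS _ Xz) e2.
have [_ [[j je <-] jz]] : [set u j | j in [set j | j.+1%:R^-1 < e / 2]] `&`
    window (k + `|i|).+1 z !=set0.
  apply: zu; last by apply/nbhs_windowP; exists (k + `|i|).+1.
  by have := near_infty_natSinv_lt (PosNum e2); apply: filterS => j ?; exists j.
have Suj : d (left_shift z) (left_shift (u j)) < e / 2.
  by apply: kP; [exact: XS|move=> n nk; apply: jz; lia].
rewrite -(eP (u j) (Xu j) _ i) //; last first.
  apply: le_lt_trans (dD _ _ _ (XS _ Xz) (XS _ (Xu j)) (Xu j)) _.
  rewrite (dC (left_shift (u j))) //; last exact: XS.
  by rewrite [ltRHS]splitr ltrD // (lt_trans (gP j)).
by apply: jz; lia.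
Qed.

Lemma left_shift_fixed (z : full_shift) :
  left_shift z = z -> forall i, z i = z 0.
Proof.
move=> zz; have zS i : z (i + 1) = z i by rewrite -[in RHS]zz.
elim/int_rec => // n IH; first by rewrite intS addrC zS.
by rewrite -zS -IH; congr (z _); rewrite intS; ring.
Qed.

(** A fixed point in X_eta is constant, so eta would contain arbitrarily long
    runs of equal symbols; runs of ones are interrupted by bZ and runs of zeros
    by the progression. *)
Lemma progression_not_proximal (R : realType) (B : set nat) d :
  (forall b, B b -> (0 < b)%N) -> B !=set0 ->
  metric_on (R := R) (orbit_closure (eta B)) d ->
  proximal (orbit_closure (eta B)) d left_shift ->
  ~ exists a L : int, 1 <= L /\
    range (fun m : int => a + L * m) `<=` [set n | eta B n = true].
Proof.
move=> hB [b Bb] hd prox [a [L [L1 aL]]].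
have [z /orbit_closureP Xz /left_shift_fixed zc] := proximal_fixed_point hd prox.
case z0 : (z 0).
- have [s zs] := Xz b; have [m sm] := progression_meets_interval 0 s (hB b Bb).
  have := zs (b%:Z * m - s) ltac:(lia).
  rewrite zc z0 /shiftz subrK; suff -> : eta B (b%:Z * m) = false by [].
  by apply/etaP; exists b => //; exact: dvdz_mulr.
- have [s zs] := Xz `|L|%N.
  have [|m sm] := @progression_meets_interval `|L|%N a s; first by lia.
  have := zs (a + `|L|%N%:Z * m - s) ltac:(lia).
  rewrite zc z0 /shiftz subrK gez0_abs; last by lia.
  by rewrite aL //; exists m.
Qed.

(** * Borel measures on the full shift *)

Lemma open_measurable_borel (A : set full_shift) :
  open A -> measurable (A : set (borel full_shift)).
Proof. by move=> oA; apply: sub_sigma_algebra. Qed.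

Lemma measurable_shift (n : int) :
  measurable_fun [set: borel full_shift]
    (shiftz n : borel full_shift -> borel full_shift).
Proof.
apply: (@measurability _ _ (borel full_shift) (borel full_shift) setT _
  (@open full_shift)) => // _ [A oA <-]; rewrite setTI.
apply: open_measurable_borel; rewrite openE => x Ax.
have /nbhs_windowP[k kA] : nbhs (shiftz n x) A by rewrite openE in oA; exact: oA.
apply/nbhs_windowP; exists (k + `|n|)%N => y yx; apply: kA => i ik.
by apply: yx; lia.
Qed.

(** The indicator function of a clopen set is a continuous test function. *)
Lemma weak_cvg_clopen (R : realType) (T : ptopologicalType)
    (mu : nat -> {measure set (borel T) -> \bar R})
    (nu : {measure set (borel T) -> \bar R}) (U : set T) :
  open U -> open (~` U) -> weak_cvg mu nu -> mu k U @[k --> \oo] --> nu U.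
Proof.
move=> oU oCU wc.
have mU : measurable (U : set (borel T)) by exact: sub_sigma_algebra.
have cU : continuous (\1_U : T -> R).
  move=> x; apply: cvg_near_cst.
  have [Ux|nUx] := pselect (U x).
    have : nbhs x U by exact: open_nbhs_nbhs.
    by apply: filterS => y Uy; rewrite !indicE !mem_set.
  have : nbhs x (~` U) by exact: open_nbhs_nbhs.
  by apply: filterS => y Uy; rewrite !indicE (memNset Uy) (memNset nUx).
have bU : bounded_fun (\1_U : T -> R).
  exists 1; split=> // M /ltW M1 x _; apply: le_trans M1.
  by rewrite /= indicE ger0_norm ?ler0n // lern1 leq_b1.
have := wc _ cU bU; rewrite integral_indic // setIT.
by under eq_fun do rewrite integral_indic // setIT.
Qed.

Lemma empirical_measureE (R : realType) (T : ptopologicalType)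
    (f : T -> T) (x : T) (N : nat) (A : set (borel T)) :
  empirical_measure R f x N A =
    ((\sum_(1 <= n < N.+1) (iter n f x \in A))%N%:R / N%:R)%:E.
Proof.
rewrite big_add1 /= big_mkord -[LHS]/((N%:R^-1)%:E *
  \sum_(i < N) dirac (iter i.+1 f x : borel T) A)%E.
under eq_bigr do rewrite diracE.
by rewrite sumEFin -EFinM mulrC natr_sum.
Qed.

(** * Recurrence *)

Section recurrence.
Context d (T : measurableType d) (R : realType)
  (P : probability T R) (f : T -> T).
Hypotheses (mf : measurable_fun setT f)
  (fP : forall A, measurable A -> P (f @^-1` A) = P A).

Lemma measurable_preimage_iter n A :
  measurable A -> measurable (iter n f @^-1` A).
Proof.
move=> mA; elim: n => [//|n IH].
rewrite (_ : _ @^-1` A = f @^-1` (iter n f @^-1` A)); last first.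
  by apply/funext => x; rewrite /preimage /= -iterS iterSr.
by rewrite -[X in measurable X]setTI; exact: mf.
Qed.

Lemma measure_preimage_iter n A : measurable A -> P (iter n f @^-1` A) = P A.
Proof.
move=> mA; elim: n => [//|n <-].
rewrite -[RHS]fP; last exact: measurable_preimage_iter.
by congr (P _); apply/funext => x; rewrite /preimage /= -iterS iterSr.
Qed.

(** The preimages of W under the iterates of f by multiples of L are pairwise
    disjoint and have the same measure, while the total mass is 1. *)
Lemma wandering_null (W : set T) (L : nat) : measurable W -> (0 < L)%N ->
  (forall n x, (L <= n)%N -> W x -> W (iter n f x) -> False) -> P W = 0%E.
Proof.
move=> mW L0 wand; pose F j := iter (j * L) f @^-1` W.
have mF j : measurable (F j) by exact: measurable_preimage_iter.
have disj i j x : (i < j)%N -> F i x -> F j x -> False.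
  move=> ij Fi; rewrite /F /preimage /= -(subnK ij) addnS -addSn mulnDl iterD.
  by apply: wand Fi; rewrite mulSn leq_addr.
have tF : trivIset setT F.
  move=> i j _ _ [x [Fi Fj]]; case: (ltngtP i j) => // ij.
    by case: (disj _ _ _ ij Fi Fj).
  by case: (disj _ _ _ ij Fj Fi).
have Pfin : P W \is a fin_num by exact: fin_num_measure.
have PF j : P (F j) = (fine (P W))%:E.
  by rewrite fineK //; exact: measure_preimage_iter.
have bound n : n%:R * fine (P W) <= 1.
  have : (P (\big[setU/set0]_(i < n) F i) <= 1)%E.
    by apply: probability_le1; exact: bigsetU_measurable.
  rewrite measure_bigsetU_ord //; last first.
    by move=> i j _ _ Fij; apply/val_inj/tF.
  rewrite (eq_bigr (fun=> (fine (P W))%:E)) => [|i _]; last exact: PF.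
  by rewrite sumEFin lee_fin sumr_const card_ord mulr_natl.
apply/eqP; rewrite -(fineK Pfin) eqe eq_le fine_ge0 ?measure_ge0 // andbT.
rewrite leNgt; apply/negP => W0.
have [n nW] := ltr_add_invr W0; rewrite add0r in nW.
have := bound n.+1; rewrite leNgt => /negP; apply.
by rewrite -ltr_pdivrMl ?ltr0n // mulr1.
Qed.

(** Poincare recurrence: the points of E that never return after time L form a
    wandering set. *)
Lemma poincare_recurrence (E : set T) (L : nat) : measurable E -> (0 < L)%N ->
  P (E `\` \bigcup_(n in [set n | (L <= n)%N]) (iter n f @^-1` E)) = 0%E.
Proof.
move=> mE L0; apply: (wandering_null _ L0) => [|n x Ln [_ nret] [Eret _]].
  apply: measurableD => //; apply: bigcup_measurable => n _.
  exact: measurable_preimage_iter.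
by apply: nret; exists n.
Qed.

End recurrence.

(** * Blocks of positive measure *)

(** The defining property of the Mirsky measure speaks about sequences along
    which the lower density is attained; such a sequence exists. *)
Lemma lower_density_subsequence (R : realType) (A : set int) :
  (lower_density R A < 1)%E ->
  exists (l : R) (N : nat -> nat), [/\ l < 1, {homo N : i j / (i < j)%N},
    lower_density R A = l%:E & (freq R A (N k))%:E @[k --> \oo] --> l%:E].
Proof.
move=> A1.
have A0 : (0 <= lower_density R A)%E.
  rewrite /lower_density limn_einf_lim (cvg_lim _ (@cvg_einfs_sup _ _)) //.
  apply: le_trans (ereal_sup_ubound (_ : _ (einfs _ 0%N))); last by exists 0%N.
  apply: le_ereal_inf_tmp => _ [n _ <-].
  by rewrite lee_fin /freq mulr_ge0 ?invr_ge0 ?ler0n.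
have Afin : lower_density R A \is a fin_num.
  by rewrite ge0_fin_numE // (lt_trans A1) // ltry.
pose l := fine (lower_density R A).
have lE : lower_density R A = l%:E by rewrite fineK.
have /choice[h hP] (p : nat * nat) :
    exists n, (p.2 <= n)%N /\ `|freq R A n - l| < p.1.+1%:R^-1.
  have r0 : 0 < p.1.+1%:R^-1 :> R by rewrite invr_gt0 ltr0n.
  by have [n] := limn_einf_approx lE r0 p.2; exists n.
pose N := fix N k := if k is k'.+1 then h (k, (N k').+1) else h (0%N, 0%N).
have Nl k : `|freq R A (N k) - l| < k.+1%:R^-1.
  by case: k => [|k]; [have [] := hP (0%N, 0%N)|have [] := hP (k.+1, (N k).+1)].
exists l, N; split => //.
- by rewrite -lte_fin -lE.
- apply: homo_ltn; first exact: ltn_trans.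
  by move=> k; have [] := hP (k.+1, (N k).+1).
- apply: cvg_EFin; first by apply: nearW.
  apply/cvgrPdist_lt => e e0; near=> k.
  rewrite distrC; apply: lt_trans (Nl k) _.
  by near: k; exact: (near_infty_natSinv_lt (PosNum e0)).
Unshelve. all: by end_near.
Qed.

(** The block is cut out by the last 1 before and the first 1 after the run of
    zeros at t, ..., t + K. *)
Lemma block_between (x : full_shift) (K t n : nat) : (t <= n)%N ->
  x 0 = true -> x n%:Z = true ->
  (forall c, (c <= K)%N -> x (t + c)%N%:Z = false) ->
  exists q k, cylinder (block (K.+1 + k)) (shiftz q%:Z x).
Proof.
move=> tn x0 xn zeros.
have exq : exists q : nat, x q%:Z && (q <= t)%N by exists 0%N; rewrite x0.
have qle q : x q%:Z && (q <= t)%N -> (q <= t)%N by case/andP.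
have exr : exists r : nat, x r%:Z && (t <= r)%N by exists n; rewrite xn.
have [q /andP[xq qt] qmax] := ex_maxnP exq qle.
have [r /andP[xr tr] rmin] := ex_minnP exr.
have rtK : (t + K < r)%N.
  rewrite ltnNge; apply/negP => rtK.
  by move: xr; rewrite -(subnKC tr) zeros //; lia.
have qt' : (q < t)%N.
  rewrite ltn_neqAle qt andbT; apply/eqP => qtE.
  by move: xq; rewrite qtE -[t]addn0 zeros.
(* There are r - q - 1 zeros between q and r, K + 1 of which are split off. *)
exists q, (r - q - K.+2)%N => i; rewrite /block /= size_rcons size_nseq => ilt.
rewrite /shiftz -PoszD; case: i ilt => [|i] ilt; first by rewrite add0n xq.
rewrite -[RHS]/(nth false (rcons (nseq (K.+1 + (r - q - K.+2)) false) true) i).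
rewrite nth_rcons size_nseq nth_nseq.
case: ltngtP => [iK|iK|iK]; [|lia|].
  apply/negP => xi; have [it|it] := leqP (i.+1 + q) t.
    by have := qmax (i.+1 + q)%N; rewrite xi it => /(_ isT); lia.
  by have := rmin (i.+1 + q)%N; rewrite xi (ltnW it) => /(_ isT); lia.
by rewrite -xr; congr (x _%:Z); lia.
Qed.

(** Suppose the blocks with more than K zeros are null.  The set E of points
    with x_0 = 1 is then covered by three null sets: the points without a run of
    K + 1 zeros starting in [0, L), those of E without a return to E after time
    L, and the shifted cylinders of long blocks.  But E has positive measure. *)
Lemma coprime_rich_blocks (R : realType) (B : set nat)
    (nu : probability (borel full_shift) R) :
  (forall b, B b -> (0 < b)%N) -> (lower_density R (multiples B) < 1)%E ->
  is_mirsky B nu -> coprime_rich B ->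
  infinite_set [set k | (1 <= k)%N /\ (0 < nu (cylinder (block k)))%E].
Proof.
move=> hB dB [nuS nuw] rich fin.
have [l [N [l1 Nmono lE cvl]]] := lower_density_subsequence dB.
have wc : weak_cvg (fun k => empirical_measure R left_shift (eta B) (N k)) nu.
  by apply: nuw => //; rewrite lE.
have [K KP] : exists K, forall k, (K < k)%N -> nu (cylinder (block k)) = 0%E.
  have /finite_seqP[X XE] := fin.
  exists (\max_(k <- X) k)%N => k Kk; apply/eqP; apply/contraT => nz.
  have : [set` X] k.
    rewrite -XE; split; first exact: leq_trans Kk.
    by rewrite lt_neqAle eq_sym nz measure_ge0.
  by rewrite /= => kX; move: Kk; rewrite ltnNge leq_bigmax_seq.
have mS : measurable_fun [set: borel full_shift]
    (left_shift : borel full_shift -> borel full_shift) := measurable_shift 1.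
pose E : set (borel full_shift) := cylinder [:: true].
have [oE oCE] : open E /\ open (~` E) := cylinder_clopen _.
have mE : measurable (E : set (borel full_shift)).
  exact: open_measurable_borel.
have EP x : E x <-> x 0 = true.
  by split=> [Ex|x0 [|]//]; exact: (Ex 0%N).
have EE x : (x \in E) = x 0.
  by apply/idP/idP => [/set_mem/EP|/EP/mem_set].
have nuCE : nu (~` E) = l%:E.
  have := weak_cvg_clopen oCE _ wc; rewrite setCK => /(_ oE) cvE.
  apply: (cvg_unique _ cvE) => //.
  rewrite (_ : (fun k => _) = (fun k => (freq R (multiples B) (N k))%:E)) //.
  apply/funext => k; rewrite empirical_measureE /freq.
  congr ((_%:R / _)%:E); apply: eq_bigr => n _; congr nat_of_bool.
  by rewrite in_setC EE iter_left_shift /shiftz add0r etaE negbK.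
have nuE : (0 < nu E)%E.
  move: nuCE; rewrite probability_setC // => nuCE.
  rewrite lt_neqAle measure_ge0 andbT eq_sym; apply/eqP => E0.
  by move: nuCE; rewrite E0 sube0 => -[l1']; move: l1; rewrite -l1' ltxx.
have [L L0 prog] := zeros_along_progression hB rich K.+1.
have [|n0 n0P] := prog [seq i%:Z | i <- iota 0 K.+1].
  by rewrite size_map size_iota.
pose A : set full_shift := [set x | exists2 t, (t < L)%N &
  forall c, (c <= K)%N -> x (t + c)%N%:Z = false].
have [oA oCA] : open A /\ open (~` A).
  apply: (@window_clopen (L + K)) => x [t tL tx] y xy; exists t => // c cK.
  by rewrite xy ?tx //; rewrite /=; lia.
(* Every shift of eta has such a run, so the empirical measures ignore ~` A. *)
have nuCA : nu (~` A) = 0%E.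
  have := weak_cvg_clopen oCA _ wc; rewrite setCK => /(_ oA) cvA.
  apply: (cvg_unique _ cvA) => //.
  rewrite (_ : (fun k => _) = cst 0%E); first exact: cvg_cst.
  apply/funext => k; rewrite empirical_measureE big1 ?mul0r // => n _.
  rewrite memNset // => /=; apply; rewrite iter_left_shift.
  have [m mn] := progression_meets_interval n0 n%:Z L0.
  (* n0 + L m is the start of a run of zeros of eta in [n, n + L). *)
  exists (absz (n0 + L%:Z * m - n%:Z)%R); first by lia.
  move=> c cK; rewrite -[RHS](n0P m c%:Z); last first.
    by rewrite map_f // mem_iota.
  by rewrite /shiftz; congr (eta B _); lia.
pose D q k : set (borel full_shift) :=
  iter q left_shift @^-1` cylinder (block (K.+1 + k)).
pose W : set (borel full_shift) :=
  E `\` \bigcup_(n in [set n | (L <= n)%N]) (iter n left_shift @^-1` E).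
have Esub : (E : set (borel full_shift)) `<=`
    (~` A `|` W) `|` \bigcup_q \bigcup_k D q k.
  move=> x Ex; have [[t tL tx]|?] := pselect (A x); last by left; left.
  have [?|/contrapT[n /= Ln /EP]] := pselect (~
    (\bigcup_(n in [set n | (L <= n)%N]) (iter n left_shift @^-1` E)) x).
    by left; right.
  rewrite iter_left_shift /shiftz add0r => xn; right.
  have [|q [k ?]] := block_between _ (proj1 (EP _) Ex) xn tx.
    by apply: leq_trans Ln; exact: ltnW.
  by exists q => //; exists k => //; rewrite /D /preimage /= iter_left_shift.
have : nu.-negligible (E : set (borel full_shift)).
  apply: (negligibleS Esub).
  apply: negligibleU; first apply: negligibleU.
  - by apply/negligibleP; first exact: open_measurable_borel.
  - apply/negligibleP; last exact: poincare_recurrence.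
    apply: measurableD => //; apply: bigcup_measurable => n _.
    exact: measurable_preimage_iter.
  - apply: negligible_bigcup => q; apply: negligible_bigcup => k.
    have mb : measurable (cylinder (block (K.+1 + k)) : set (borel full_shift)).
      by apply: open_measurable_borel; have [] := cylinder_clopen (block (K.+1 + k)).
    apply/negligibleP; first exact: measurable_preimage_iter.
    apply: etrans (measure_preimage_iter mS nuS q mb) _.
    by apply: KP; rewrite addSn ltnS leq_addr.
by move=> /(negligibleP _ mE) E0; move: nuE; rewrite E0 ltxx.
Qed.

(** * The dichotomy *)

(* [hB0] and [hBd] cannot be dropped: for B empty, and for B with multiples of
   lower density 1 (B = {1}, or the primes), X_eta is proximal while every block
   10...01 with k >= 1 zeros has Mirsky measure 0. *)
Theorem proposition1p20 (R : realType) (B : set nat)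
    (hB : forall b, B b -> (0 < b)%N)
    (hB0 : B !=set0)
    (hBd : (lower_density R (multiples B) < 1)%E)
    (d : full_shift -> full_shift -> R)
    (hd : metric_on (orbit_closure (eta B)) d)
    (nu : probability (borel full_shift) R)
    (hnu : is_mirsky B nu) :
  exactly_one
    (proximal (orbit_closure (eta B)) d left_shift /\
     infinite_set [set k | (1 <= k)%N /\ (0 < nu (cylinder (block k)))%E])
    (~ proximal (orbit_closure (eta B)) d left_shift /\
     exists a L : int, 1 <= L /\
       range (fun m : int => a + L * m) `<=` [set n | eta B n = true]).
Proof.
split; last by case=> -[prox _] [].
have [rich|nrich] := pselect (coprime_rich B).
  left; split; first exact: (coprime_rich_proximal hB hd rich).
  exact: (coprime_rich_blocks hB hBd hnu rich).
have prog := not_coprime_rich_progression nrich.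
by right; split=> // prox; exact: (progression_not_proximal hB hB0 hd prox prog).
Qed.
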